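(* (Multiple samples.) Let $n,m,l\ge 1$, $F\in\mathcal{L}_{2^n\times 2^{m+n}}$, $H\in\mathcal{L}_{2^l\times 2^n}$, and consider the Boolean control network $$x(t+1)=F\,(u(t)\otimes x(t)),\qquad y(t)=Hx(t),\qquad t\in\mathbb{N},$$ with $x(t)\in\Delta_{2^n}$, $u(t)\in\Delta_{2^m}$, $y(t)\in\Delta_{2^l}$. Suppose the set of initial states (of the samples) is $P_0\subseteq\Delta_{2^n}$. If the Boolean control network is set-$P_0$ controllable and O1-observable, then it is uniquely identifiable. That is: if $F'\in\mathcal{L}_{2^n\times 2^{m+n}}$ and $H'\in\mathcal{L}_{2^l\times 2^n}$ are such that the Boolean control network $(F',H')$ generates the available data recorded from $(F,H)$ with set of initial states $P_0$, then there is a $2^n\times 2^n$ permutation matrix $G$ with $F'=GF(I_{2^m}\otimes G^{\mathrm T})$ and $H'=HG^{\mathrm T}$.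
   Context: Notation: $\mathbb{N}=\{0,1,2,\dots\}$; $\delta_k^i$ is the $i$-th column of the identity matrix $I_k$; $\Delta_k=\{\delta_k^1,\dots,\delta_k^k\}$; $\mathcal{L}_{p\times q}$ is the set of real $p\times q$ matrices all of whose columns lie in $\Delta_p$; $\otimes$ is the Kronecker product. Set-$P_0$ controllability: the Boolean control network is set-$P_0$ controllable if for every $x_d\in\Delta_{2^n}$ there exist a state $x(0)=x_0\in P_0$, a $T\in\mathbb{N}$ and an input sequence $(u(0),\dots,u(T))$ in $\Delta_{2^m}$ such that $x(T+1)=x_d$. O1-observability: for any two distinct states $x(0)\neq\bar x(0)$ in $\Delta_{2^n}$ there exists an input sequence $(u(0),u(1),\dots)$ in $\Delta_{2^m}$ such that the corresponding output sequences (generated from $x(0)$ and $\bar x(0)$ under this same input) are distinct: $(y(0),y(1),\dots)\neq(\bar y(0),\bar y(1),\dots)$. Available data (multiple samples, sufficient data): samples are collected whose unknown initial states make up $P_0$; each sample is divided into portions with the same initial state, and to each portion an input sequence is applied and the resulting output sequence is recorded. The data are assumed sufficient, i.e. they contain everything the system can generate from $P_0$. So for each sample, with initial state $x_0\in P_0$, the available data are the pairs consisting of an arbitrary input sequence $(u(0),\dots,u(p))$, $p\in\mathbb{N}$, and the output sequence $(y(0),\dots,y(p+1))$ it produces from $x(0)=x_0$. A Boolean control network $(F',H')$ generates these data if for every $x_0\in P_0$ there is a state $x_0'\in\Delta_{2^n}$ such that, for every $p$ and every input sequence $(u(0),\dots,u(p))$, the network $(F',H')$ started at $x_0'$ produces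 the same output sequence as $(F,H)$ started at $x_0$. Unique identifiability: $F,H$ are determined by the available data up to a coordinate change $\omega=Gx$ of the state ($G$ a permutation matrix), under which $(F,H)$ becomes $(GF(I_{2^m}\otimes G^{\mathrm T}),HG^{\mathrm T})$. The dimensions $n,m,l$ are known. *)

(* Defs.v *)
From mathcomp Require Import all_boot all_order all_algebra.
From mathcomp Require Import all_classical reals.
From mathcomp Require Export mxtens.

Set Implicit Arguments.
Unset Strict Implicit.
Unset Printing Implicit Defensive.

Import GRing.Theory.
Local Open Scope classical_set_scope.
Local Open Scope ring_scope.

Definition Delta (R : realType) (k : nat) : set 'cV[R]_k :=
  [set x | exists i : 'I_k, x = col i 1%:M].

Definition logical_mx (R : realType) (p q : nat) : set 'M[R]_(p, q) :=
  [set A | forall j : 'I_q, Delta (col j A)].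

(* The Kronecker product [tensmx] (infix [*t]) multiplies dimensions, so the
   number 2^(m+n) of columns of F is written 2^m * 2^n throughout; the column
   dimension 1 * 1 of [u t *t x] is convertible to 1. *)
Fixpoint state (R : realType) (n m : nat)
    (F : 'M[R]_((2 ^ n)%N, (2 ^ m * 2 ^ n)%N))
    (u : nat -> 'cV[R]_(2 ^ m)%N) (x0 : 'cV[R]_(2 ^ n)%N) (t : nat) :
    'cV[R]_(2 ^ n)%N :=
  if t is s.+1 then F *m (u s *t state F u x0 s) else x0.

Definition output (R : realType) (n m l : nat)
    (F : 'M[R]_((2 ^ n)%N, (2 ^ m * 2 ^ n)%N))
    (H : 'M[R]_((2 ^ l)%N, (2 ^ n)%N))
    (u : nat -> 'cV[R]_(2 ^ m)%N) (x0 : 'cV[R]_(2 ^ n)%N) (t : nat) :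
    'cV[R]_(2 ^ l)%N :=
  H *m state F u x0 t.

(* A finite input sequence (u(0), ..., u(T)) is represented by a function on
   [nat] of which only the first T+1 values are constrained and used. *)
Definition set_controllable (R : realType) (n m : nat)
    (F : 'M[R]_((2 ^ n)%N, (2 ^ m * 2 ^ n)%N))
    (P0 : set 'cV[R]_(2 ^ n)%N) : Prop :=
  forall xd : 'cV[R]_(2 ^ n)%N, Delta xd ->
  exists (x0 : 'cV[R]_(2 ^ n)%N) (T : nat) (u : nat -> 'cV[R]_(2 ^ m)%N),
    [/\ P0 x0, forall t : nat, (t <= T)%N -> Delta (u t)
      & state F u x0 T.+1 = xd].

Definition O1_observable (R : realType) (n m l : nat)
    (F : 'M[R]_((2 ^ n)%N, (2 ^ m * 2 ^ n)%N))
    (H : 'M[R]_((2 ^ l)%N, (2 ^ n)%N)) : Prop :=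
  forall x xbar : 'cV[R]_(2 ^ n)%N, Delta x -> Delta xbar -> x <> xbar ->
  exists2 u : nat -> 'cV[R]_(2 ^ m)%N,
    forall t : nat, Delta (u t) & output F H u x <> output F H u xbar.

(* The inputs are u(0), ..., u(p) and the recorded outputs y(0), ..., y(p+1).
   The state x0' may depend on the sample x0, but not on p or u. *)
Definition generates_data (R : realType) (n m l : nat)
    (F : 'M[R]_((2 ^ n)%N, (2 ^ m * 2 ^ n)%N))
    (H : 'M[R]_((2 ^ l)%N, (2 ^ n)%N))
    (P0 : set 'cV[R]_(2 ^ n)%N)
    (F' : 'M[R]_((2 ^ n)%N, (2 ^ m * 2 ^ n)%N))
    (H' : 'M[R]_((2 ^ l)%N, (2 ^ n)%N)) : Prop :=
  forall x0 : 'cV[R]_(2 ^ n)%N, P0 x0 ->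
  exists2 x0' : 'cV[R]_(2 ^ n)%N, Delta x0' &
    forall (p : nat) (u : nat -> 'cV[R]_(2 ^ m)%N),
      (forall t : nat, (t <= p)%N -> Delta (u t)) ->
      forall t : nat, (t <= p.+1)%N ->
        output F' H' u x0' t = output F H u x0 t.

Definition uniquely_identifiable (R : realType) (n m l : nat)
    (F : 'M[R]_((2 ^ n)%N, (2 ^ m * 2 ^ n)%N))
    (H : 'M[R]_((2 ^ l)%N, (2 ^ n)%N))
    (P0 : set 'cV[R]_(2 ^ n)%N) : Prop :=
  forall (F' : 'M[R]_((2 ^ n)%N, (2 ^ m * 2 ^ n)%N))
    (H' : 'M[R]_((2 ^ l)%N, (2 ^ n)%N)),
  logical_mx F' -> logical_mx H' -> generates_data F H P0 F' H' ->
  exists G : 'M[R]_(2 ^ n)%N,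
    [/\ is_perm_mx G, F' = G *m F *m ((1%:M : 'M[R]_(2 ^ m)%N) *t G^T)
      & H' = H *m G^T].

(* Main.v *)
(** Say that a state x of (F, H) matches a state x' of (F', H') when both
    produce the same outputs under every input sequence.  Matching propagates
    along the dynamics, so by controllability every state x of (F, H) matches
    some x' = phi x; by observability phi is injective, hence a permutation of
    the finite state set.  The successor of phi x under an input w matches the
    successor of x and is of the form phi z, so by observability z is the
    successor of x: phi is the required coordinate change. *)
Require Import Defs.
From mathcomp Require Import all_boot all_order all_algebra all_fingroup.
From mathcomp Require Import all_classical reals.

Set Implicit Arguments.
Unset Strict Implicit.
Unset Printing Implicit Defensive.

Import GRing.Theory.
Local Open Scope classical_set_scope.
Local Open Scope ring_scope.

Section LogicalMatrices.
Context {R : realType}.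

Lemma DeltaP k (x : 'cV[R]_k) : Delta x <-> exists i, x = delta_mx i 0.
Proof. by split=> -[i ->]; exists i; rewrite col1. Qed.

Lemma Delta_delta k (i : 'I_k) : Delta (delta_mx i 0 : 'cV[R]_k).
Proof. by apply/DeltaP; exists i. Qed.

Lemma delta_mx_inj k : injective (fun i : 'I_k => delta_mx i 0 : 'cV[R]_k).
Proof.
move=> i j /matrixP/(_ i 0); rewrite !mxE !eqxx !andbT.
by case: eqP => [//|_] /eqP; rewrite oner_eq0.
Qed.

Lemma tens_delta_mx m n (i : 'I_m) (j : 'I_n) :
  (delta_mx i 0 : 'cV[R]_m) *t (delta_mx j 0 : 'cV[R]_n)
    = delta_mx (mxtens_index (i, j)) 0 :> 'cV[R]_(m * n).
Proof.
apply/matrixP => k c; case: (mxtens_indexP k) => a b.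
rewrite !mxE !mxtens_indexK /= !ord1 !eqxx !andbT.
by rewrite (can_eq (@mxtens_indexK m n)) xpair_eqE -natrM mulnb.
Qed.

Lemma Delta_tens m n (u : 'cV[R]_m) (x : 'cV[R]_n) :
  Delta u -> Delta x -> Delta (u *t x : 'cV[R]_(m * n)).
Proof.
by move=> /DeltaP[i ->] /DeltaP[j ->]; rewrite tens_delta_mx; exact: Delta_delta.
Qed.

Lemma Delta_logical_mul p q (A : 'M[R]_(p, q)) (x : 'cV[R]_q) :
  logical_mx A -> Delta x -> Delta (A *m x).
Proof. by move=> LA /DeltaP[j ->]; rewrite -colE; exact: LA. Qed.

Lemma eq_mx_delta p q (A B : 'M[R]_(p, q)) :
  (forall j, A *m delta_mx j (0 : 'I_1) = B *m delta_mx j 0) -> A = B.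
Proof.
move=> AB; apply/matrixP => i j.
by have /matrixP/(_ i 0) := AB j; rewrite -!colE !mxE.
Qed.

(** [mxtens_index] is a bijection, so the tensors of basis vectors are exactly the basis vectors of
    the product. *)
Lemma eq_mx_tens_delta p m n (A B : 'M[R]_(p, m * n)) :
  (forall (i : 'I_m) (j : 'I_n),
     A *m (delta_mx i (0 : 'I_1) *t delta_mx j (0 : 'I_1)) =
     B *m (delta_mx i (0 : 'I_1) *t delta_mx j (0 : 'I_1))) -> A = B.
Proof.
move=> AB; apply: eq_mx_delta => k; case: (mxtens_indexP k) => i j.
by have := AB i j; rewrite tens_delta_mx.
Qed.

End LogicalMatrices.

Section Trajectories.
Context {R : realType} {n m : nat}.
Implicit Types (F : 'M[R]_((2 ^ n)%N, (2 ^ m * 2 ^ n)%N)).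
Implicit Types (u v : nat -> 'cV[R]_(2 ^ m)%N) (x : 'cV[R]_(2 ^ n)%N).

Lemma Delta_state F u x s : logical_mx F -> Delta x ->
  (forall t, (t < s)%N -> Delta (u t)) -> Delta (state F u x s).
Proof.
move=> LF Dx; elim: s => [//|s IHs] Du /=.
apply: Delta_logical_mul => //; apply: Delta_tens; first exact: Du.
by apply: IHs => t ts; apply: Du; exact: ltnW.
Qed.

Lemma eq_state F u v x s :
  (forall t, (t < s)%N -> u t = v t) -> state F u x s = state F v x s.
Proof.
elim: s => [//|s IHs] uv /=; rewrite uv // IHs // => t ts.
by apply: uv; exact: ltnW.
Qed.

Definition cat_input u s v t := if (t < s)%N then u t else v (t - s)%N.

Lemma state_cat_input F u s v x t :
  state F (cat_input u s v) x (s + t) = state F v (state F u x s) t.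
Proof.
elim: t => [|t IHt].
  by rewrite addn0; apply: eq_state => t ts; rewrite /cat_input ts.
by rewrite addnS /= IHt /cat_input ltnNge leq_addr addKn.
Qed.

End Trajectories.

Section Matching.
Context {R : realType} {n m l : nat}.
Variables (F F' : 'M[R]_((2 ^ n)%N, (2 ^ m * 2 ^ n)%N)).
Variables (H H' : 'M[R]_((2 ^ l)%N, (2 ^ n)%N)).
Implicit Types (x z : 'cV[R]_(2 ^ n)%N).

(** Unlike the data, this uses inputs admissible at all times, so that no horizon has to be
    tracked. *)
Definition matches x x' := forall u : nat -> 'cV[R]_(2 ^ m)%N,
  (forall t, Delta (u t)) -> forall t, output F' H' u x' t = output F H u x t.

Lemma matches_output x x' : matches x x' -> H' *m x' = H *m x.
Proof.
(* Even the output at time 0 is only compared under an admissible input, so one must exist. *)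
have i : 'I_(2 ^ m) := Ordinal (expn_gt0 2 m).
move=> /(_ (fun=> delta_mx i 0)) /(_ (fun=> Delta_delta i)) /(_ 0%N).
exact.
Qed.

(** Any test input [v] applied after [s] steps is the tail of the admissible input [cat_input u s v]
    applied to [x] and [x']. *)
Lemma matches_state x x' u s : (forall t, (t < s)%N -> Delta (u t)) ->
  matches x x' -> matches (state F u x s) (state F' u x' s).
Proof.
move=> Du xx' v Dv t; rewrite /output -!state_cat_input; apply: xx' => k.
by rewrite /cat_input; case: ifP => // /Du.
Qed.

Lemma matches_step x x' (w : 'cV[R]_(2 ^ m)%N) : Delta w -> matches x x' ->
  matches (F *m (w *t x)) (F' *m (w *t x')).
Proof.
by move=> Dw; apply: (@matches_state _ _ (fun=> w) 1) => t _.
Qed.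

(** Both states reproduce the outputs of [x'], so no input can distinguish them. *)
Lemma matches_inj x z x' : O1_observable (m := m) F H -> Delta x -> Delta z ->
  matches x x' -> matches z x' -> x = z.
Proof.
move=> obs Dx Dz xx' zx'; apply: contrapT => /(obs _ _ Dx Dz)[u Du]; apply.
by apply/funext => t; rewrite -xx' // -zx'.
Qed.

Lemma generates_data_matches (P0 : set 'cV[R]_(2 ^ n)%N) x :
  generates_data F H P0 F' H' -> P0 x ->
  exists2 x', Delta x' & matches x x'.
Proof.
move=> gen /gen[x' Dx' xx']; exists x' => // u Du t.
(* The output at time [t] is among those recorded with horizon [p = t]. *)
by apply: (xx' t) => // k _; exact: Du.
Qed.

(** The input steering some sample state to [x] carries the match of that sample along with it. *)
Lemma controllable_matches (P0 : set 'cV[R]_(2 ^ n)%N) x : logical_mx F' ->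
  set_controllable F P0 -> generates_data F H P0 F' H' -> Delta x ->
  exists2 x', Delta x' & matches x x'.
Proof.
move=> LF' ctrl gen /ctrl[x0 [T [u [Px0 Du <-]]]].
have [x0' Dx0' mx0] := generates_data_matches gen Px0.
exists (state F' u x0' T.+1); first exact: Delta_state.
exact: matches_state.
Qed.

Lemma matching_perm (P0 : set 'cV[R]_(2 ^ n)%N) : logical_mx F' ->
  O1_observable (m := m) F H -> set_controllable F P0 ->
  generates_data F H P0 F' H' ->
  exists s : {perm 'I_(2 ^ n)%N},
    forall i, matches (delta_mx i 0) (delta_mx (s i) 0).
Proof.
move=> LF' obs ctrl gen.
have /choice[f fP] (i : 'I_(2 ^ n)%N) :
    exists j, matches (delta_mx i 0) (delta_mx j 0).
  have [_ /DeltaP[j ->] ij] :=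
    controllable_matches LF' ctrl gen (Delta_delta i).
  by exists j.
(* Two indices with the same image give two states matching a common one, against observability. *)
have f_inj : injective f.
  move=> i j fij; have := fP j; rewrite -fij => ji.
  exact: delta_mx_inj (matches_inj obs (Delta_delta i) (Delta_delta j) (fP i) ji).
by exists (perm f_inj) => i; rewrite permE.
Qed.

End Matching.

(** Acting on columns, [perm_mx s] moves indices by the inverse of [s]. *)
Lemma perm_mx_delta (R : realType) k (s : {perm 'I_k}) (j : 'I_k) :
  perm_mx s *m delta_mx (s j) 0 = delta_mx j 0 :> 'cV[R]_k.
Proof.
by rewrite -row_permE; apply/matrixP => a b; rewrite !mxE (inj_eq perm_inj).
Qed.

Theorem theorem3p14 (R : realType) (n m l : nat)
    (F : 'M[R]_((2 ^ n)%N, (2 ^ m * 2 ^ n)%N))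
    (H : 'M[R]_((2 ^ l)%N, (2 ^ n)%N))
    (P0 : set 'cV[R]_(2 ^ n)%N) :
  (1 <= n)%N -> (1 <= m)%N -> (1 <= l)%N ->
  logical_mx F -> logical_mx H -> P0 `<=` @Delta R (2 ^ n)%N ->
  set_controllable F P0 -> O1_observable F H ->
  uniquely_identifiable F H P0.
Proof.
move=> _ _ _ LF _ _ ctrl obs F' H' LF' _ gen.
have [s sP] := matching_perm LF' obs ctrl gen.
have sV i : perm_mx s^-1%g *m delta_mx i 0 = delta_mx (s i) 0 :> 'cV[R]_(2 ^ n)%N.
  by rewrite -{1}(permK s i) perm_mx_delta.
(* By [sV], this is the matrix that sends each basis state to its match; its transpose is
   [perm_mx s]. *)
exists (perm_mx s^-1%g); rewrite tr_perm_mx invgK; split.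
- exact: perm_mx_is_perm.
(* Writing [j] as [s i] lets the transpose of [G] bring the state back to index [i]. *)
- apply: eq_mx_tens_delta => w j; rewrite -(permKV s j).
  move: (s^-1%g j) => {j} i.
  rewrite -!mulmxA tensmx_mul mul1mx perm_mx_delta.
  have Dw := @Delta_delta R _ w.
  have mstep := matches_step Dw (sP i).
  have /DeltaP[z Fz] := Delta_logical_mul LF (Delta_tens Dw (Delta_delta i)).
  have /DeltaP[z' Fz'] :=
    Delta_logical_mul LF' (Delta_tens Dw (Delta_delta (s i))).
  (* The successor [z'] is matched both by [z] and by its preimage under [s]; observability
     identifies the two. *)
  move: mstep; rewrite Fz Fz' sV -(permKV s z') => mstep.
  by rewrite (delta_mx_inj
    (matches_inj obs (Delta_delta _) (Delta_delta _) mstep (sP _))).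
- apply: eq_mx_delta => j; rewrite -(permKV s j) -mulmxA perm_mx_delta.
  exact: matches_output (sP _).
Qed.
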